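(* If $U$ is consistent and effectively Friedman-reflexive, then $U$ is essentially undecidable (every consistent extension of $U$ in the same language is undecidable).
   Context: Theories are first-order theories in finite signature with arbitrary axiom sets; interpretations may be multi-dimensional and piecewise; $V\rhd W$ means $V$ interprets $W$. A $U$-sentence $C$ is an interpreter of finitely axiomatised $A$ over $U$ iff for all $U$-sentences $B$: $(U+B)\rhd A$ iff $U+B\vdash C$. $U$ is effectively Friedman-reflexive iff there is a recursive function assigning to each finitely axiomatised $A$ an interpreter of $A$ over $U$. *)

(* Defs.v *)
From mathcomp Require Import all_boot.
From Stdlib Require List.

Set Implicit Arguments.
Unset Strict Implicit.
Unset Printing Implicit Defensive.

Inductive recf : nat -> Type :=
| Zero n : recf n
| Succ : recf 1
| Proj n (i : 'I_n) : recf n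
| Comp m n (f : recf m) (gs : 'I_m -> recf n) : recf n
| Prec n (f : recf n) (g : recf n.+2) : recf n.+1
| Mu n (f : recf n.+1) : recf n.

(* The graph of primitive recursion on the first argument: the step function
   receives the counter, the previous value and the parameters. *)
Fixpoint prec_graph n (f : n.-tuple nat -> nat -> Prop)
    (g : n.+2.-tuple nat -> nat -> Prop) (xs : n.-tuple nat) (k z : nat) : Prop :=
  if k is j.+1 then
    exists2 y, prec_graph f g xs j y & g [tuple of j :: y :: xs] z
  else f xs z.

(* [eval p xs z]: the partial recursive function p, at xs, converges to z. *)
Fixpoint eval n (p : recf n) : n.-tuple nat -> nat -> Prop :=
  match p in recf n return n.-tuple nat -> nat -> Prop with
  | Zero _ => fun _ z => z = 0
  | Succ => fun xs z => z = (thead xs).+1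
  | Proj _ i => fun xs z => z = tnth xs i
  | Comp m _ f gs => fun xs z =>
      exists2 ys : m.-tuple nat,
        forall i, eval (gs i) xs (tnth ys i) & eval f ys z
  | Prec _ f g => fun xs z =>
      prec_graph (eval f) (eval g) [tuple of behead xs] (thead xs) z
  | Mu _ f => fun xs z =>
      eval f [tuple of z :: xs] 0 /\
      forall j, j < z -> exists y, eval f [tuple of j :: xs] y.+1
  end.

Definition recursive (h : nat -> nat) : Prop :=
  exists p : recf 1, forall x, eval p [tuple x] (h x).

Definition recursive_set (P : nat -> Prop) : Prop :=
  exists2 d : nat -> bool,
    recursive (fun x => nat_of_bool (d x)) & forall x, P x <-> d x.

(* The i-th entry of a list is the arity of the i-th symbol. *)
Record signature := Signature {
  fun_arities : seq nat;
  rel_arities : seq nat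
}.

Definition fsym (S : signature) := 'I_(size (fun_arities S)).
Definition rsym (S : signature) := 'I_(size (rel_arities S)).
Definition far (S : signature) (f : fsym S) : nat := nth 0 (fun_arities S) f.
Definition rar (S : signature) (r : rsym S) : nat := nth 0 (rel_arities S) r.

(* Variables are de Bruijn indices. *)
Inductive term (S : signature) : Type :=
| Var of nat
| App (f : fsym S) of {ffun 'I_(far f) -> term S}.

Arguments Var {S}.
Arguments App {S}.

Inductive form (S : signature) : Type :=
| Bot
| Eq of term S & term S
| Rel (r : rsym S) of {ffun 'I_(rar r) -> term S}
| Imp of form S & form S
| All of form S.

Arguments Bot {S}.
Arguments Rel {S}.

Definition Neg S (phi : form S) : form S := Imp phi Bot.
Definition Top {S} : form S := Neg Bot.
Definition And S (phi psi : form S) : form S := Neg (Imp phi (Neg psi)).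
Definition Ex S (phi : form S) : form S := Neg (All (Neg phi)).
Definition Conj S (s : seq (form S)) : form S := foldr (@And S) Top s.

Fixpoint bounded_term S (n : nat) (t : term S) : Prop :=
  match t with
  | Var m => m < n
  | App _ a => forall i, bounded_term n (a i)
  end.

Fixpoint bounded S (n : nat) (phi : form S) : Prop :=
  match phi with
  | Bot => True
  | Eq t u => bounded_term n t /\ bounded_term n u
  | Rel _ a => forall i, bounded_term n (a i)
  | Imp phi psi => bounded n phi /\ bounded n psi
  | All phi => bounded n.+1 phi
  end.

Definition sentence S (phi : form S) : Prop := bounded 0 phi.

Fixpoint subst_term S (s : nat -> term S) (t : term S) : term S :=
  match t with
  | Var n => s n
  | App f a => App f [ffun i => subst_term s (a i)]
  end.

Definition up S (s : nat -> term S) (n : nat) : term S :=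
  if n is m.+1 then subst_term (fun k => Var k.+1) (s m) else Var 0.

Fixpoint subst_form S (s : nat -> term S) (phi : form S) : form S :=
  match phi with
  | Bot => Bot
  | Eq t u => Eq (subst_term s t) (subst_term s u)
  | Rel r a => Rel r [ffun i => subst_term s (a i)]
  | Imp phi psi => Imp (subst_form s phi) (subst_form s psi)
  | All phi => All (subst_form (up s) phi)
  end.

Definition shift S (phi : form S) : form S := subst_form (fun n => Var n.+1) phi.

Definition inst S (t : term S) (phi : form S) : form S :=
  subst_form (fun n => if n is m.+1 then Var m else t) phi.

Definition extend S (T : form S -> Prop) (phi : form S) : form S -> Prop :=
  fun psi => T psi \/ psi = phi.

Inductive proves S : (form S -> Prop) -> form S -> Prop :=
| Ax T phi : T phi -> proves T phi
| ImpI T phi psi : proves (extend T phi) psi -> proves T (Imp phi psi)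
| ImpE T phi psi : proves T (Imp phi psi) -> proves T phi -> proves T psi
| Raa T phi : proves (extend T (Neg phi)) Bot -> proves T phi
| AllI T phi :
    proves (fun psi => exists2 chi, T chi & psi = shift chi) phi ->
    proves T (All phi)
| AllE T phi t : proves T (All phi) -> proves T (inst t phi)
| EqI T t : proves T (Eq t t)
| EqE T phi t u :
    proves T (Eq t u) -> proves T (inst t phi) -> proves T (inst u phi).

Definition theory S (T : form S -> Prop) : Prop := forall phi, T phi -> sentence phi.

Definition consistent S (T : form S -> Prop) : Prop := ~ proves T Bot.

Definition extends S (T U : form S -> Prop) : Prop :=
  forall phi, sentence phi -> proves U phi -> proves T phi.

(* A finitely axiomatised theory is a signature with a list of sentences. *)
Definition fin_axioms S (A : seq (form S)) : form S -> Prop :=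
  fun phi => List.In phi A.

(* Function symbols are interpreted through their graphs: a formula is first
   rewritten into an equivalent one whose atomic subformulas are of the form
   x = y, f(x_1,...,x_n) = y or R(x_1,...,x_n) with variables as arguments. *)

Definition is_var S (t : term S) : bool := if t is Var _ then true else false.

(* An unnested formula for "t = x_y", the variables of t being raised by d. *)
Fixpoint graph S (d : nat) (t : term S) (y : nat) : form S :=
  match t with
  | Var x => Eq (Var (x + d)) (Var y)
  | App f a =>
      let n := far f in
      if [forall i, is_var (a i)] then
        Eq (App f [ffun i => subst_term (fun x => Var (x + d)) (a i)]) (Var y)
      else
        iter n (@Ex S)
          (And (Conj [seq graph (d + n) (a i) i | i <- enum 'I_n])
               (Eq (App f [ffun i : 'I_n => Var i]) (Var (y + n))))
  end.

Fixpoint unnest S (phi : form S) : form S :=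
  match phi with
  | Bot => Bot
  | Eq t (Var y) => graph 0 t y
  | Eq (Var x) u => graph 0 u x
  | Eq t u => Ex (And (graph 1 t 0) (graph 1 u 0))
  | Rel r a =>
      let n := rar r in
      if [forall i, is_var (a i)] then Rel r a
      else
        iter n (@Ex S)
          (And (Conj [seq graph n (a i) i | i <- enum 'I_n])
               (Rel r [ffun i : 'I_n => Var i]))
  | Imp phi psi => Imp (unnest phi) (unnest psi)
  | All phi => All (unnest phi)
  end.

(* An object of piece p is a block of [dim p] variables.  In the formulas below
   the blocks of the arguments occupy consecutive free variables from 0 on, in
   the order of the arguments; for a function symbol, the block of the value
   comes last. *)
Record translation (L S : signature) := Translation {
  last_piece : nat;
  piece := 'I_last_piece.+1;
  dim : piece -> nat;
  tdom : piece -> form S;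
  teq : piece -> piece -> form S;
  trel : forall r : rsym L, {ffun 'I_(rar r) -> piece} -> form S;
  tfun : forall f : fsym L, {ffun 'I_(far f) -> piece} -> piece -> form S;
  dim_gt0 : forall p, 0 < dim p;
  tdom_bounded : forall p, bounded (dim p) (tdom p);
  teq_bounded : forall p q, bounded (dim p + dim q) (teq p q);
  trel_bounded : forall r (ps : {ffun 'I_(rar r) -> piece}),
    bounded (\sum_i dim (ps i)) (trel ps);
  tfun_bounded : forall f (ps : {ffun 'I_(far f) -> piece}) q,
    bounded (\sum_i dim (ps i) + dim q) (tfun ps q)
}.

Arguments trel {L S} _ {r}.
Arguments tfun {L S} _ {f}.

Definition apply_vars S (phi : form S) (xs : seq nat) : form S :=
  subst_form (fun i => Var (nth 0 xs i)) phi.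

Definition value L S (tau : translation L S) : Type := piece tau * seq nat.

Definition push L S (tau : translation L S) (p : piece tau)
    (e : nat -> value tau) (n : nat) : value tau :=
  if n is m.+1 then ((e m).1, [seq x + dim p | x <- (e m).2])
  else (p, iota 0 (dim p)).

(* Only relevant on variables, as unnested formulas apply symbols to variables. *)
Definition arg L S (tau : translation L S) (e : nat -> value tau)
    (t : term L) : value tau :=
  if t is Var n then e n else (ord0, [::]).

Definition blocks L S (tau : translation L S) (e : nat -> value tau)
    n (a : {ffun 'I_n -> term L}) : seq nat :=
  flatten [seq (arg e (a i)).2 | i <- enum 'I_n].

Fixpoint translate L S (tau : translation L S) (e : nat -> value tau)
    (phi : form L) : form S :=
  match phi with
  | Bot => Bot
  | Eq (Var x) u =>
      apply_vars (teq (e x).1 (arg e u).1) ((e x).2 ++ (arg e u).2)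
  | Eq (App f a) u =>
      apply_vars (tfun tau [ffun i => (arg e (a i)).1] (arg e u).1)
                 (blocks e a ++ (arg e u).2)
  | Rel r a => apply_vars (trel tau [ffun i => (arg e (a i)).1]) (blocks e a)
  | Imp phi psi => Imp (translate e phi) (translate e psi)
  | All phi =>
      Conj [seq iter (dim p) (@All S) (Imp (tdom p) (translate (push p e) phi))
           | p <- enum {: piece tau}]
  end.

(* The environment is irrelevant for a sentence. *)
Definition translate_sentence L S (tau : translation L S) (phi : form L) : form S :=
  translate (tau := tau) (fun _ => (ord0, nseq (dim (ord0 : piece tau)) 0)) (unnest phi).

(* All theorems are required to translate to theorems, so that non-emptiness of
   the domain, the laws of identity and totality of functions are included. *)
Definition interprets S L (V : form S -> Prop) (W : form L -> Prop) : Prop :=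
  exists tau : translation L S, forall phi : form L,
    sentence phi -> proves W phi -> proves V (translate_sentence tau phi).

Fixpoint code_term S (t : term S) : nat :=
  match t with
  | Var n => CodeSeq.code [:: 0; n]
  | App f a =>
      CodeSeq.code [:: 1, nat_of_ord f & [seq code_term (a i) | i <- enum 'I_(far f)]]
  end.

Fixpoint code_form S (phi : form S) : nat :=
  match phi with
  | Bot => CodeSeq.code [:: 0]
  | Eq t u => CodeSeq.code [:: 1; code_term t; code_term u]
  | Rel r a =>
      CodeSeq.code [:: 2, nat_of_ord r & [seq code_term (a i) | i <- enum 'I_(rar r)]]
  | Imp phi psi => CodeSeq.code [:: 3; code_form phi; code_form psi]
  | All phi => CodeSeq.code [:: 4; code_form phi]
  end.

Definition code_fin_axioms S (A : seq (form S)) : nat :=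
  CodeSeq.code [:: CodeSeq.code (fun_arities S); CodeSeq.code (rel_arities S);
                   CodeSeq.code [seq code_form phi | phi <- A]].

Definition decidable_theory S (T : form S -> Prop) : Prop :=
  recursive_set (fun x =>
    exists phi : form S, [/\ sentence phi, x = code_form phi & proves T phi]).

Definition essentially_undecidable S (U : form S -> Prop) : Prop :=
  forall V : form S -> Prop,
    theory V -> extends V U -> consistent V -> ~ decidable_theory V.

Definition interpreter S L (U : form S -> Prop) (A : form L -> Prop) (C : form S) : Prop :=
  sentence C /\
  forall B : form S, sentence B ->
    (interprets (extend U B) A <-> proves (extend U B) C).

Definition effectively_friedman_reflexive S (U : form S -> Prop) : Prop :=
  exists2 h : nat -> nat, recursive h &
    forall (L : signature) (A : seq (form L)), theory (fin_axioms A) ->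
      exists2 C : form S, h (code_fin_axioms A) = code_form C &
        interpreter U (fin_axioms A) C.

(* Main.v *)
Require Import Defs.
From mathcomp Require Import all_boot.
From mathcomp Require Import boolp zify.
From HB Require Import structures.

Set Implicit Arguments.
Unset Strict Implicit.
Unset Printing Implicit Defensive.

(* Suppose that V is a consistent decidable extension of U, and let C_A be the
   interpreter of A.  If A has a finite model, then U interprets A (one piece per
   element of the model), so V proves C_A.  If A is inconsistent, then U + C_A is
   inconsistent, so V refutes C_A.  Hence the decidable set of those A for which V
   proves C_A separates the A with a finite model from the inconsistent A, against
   Trakhtenbrot's theorem, of which the needed instance is proved by diagonalisation.
   A program p tells, from the codes b and l of a signature and of a list of axioms,
   whether V proves C_A, where A consists of these axioms and of "p(b, l) is not 1".
   Take for b and l the Horn clauses that define the computations of p.  If p(b, l) = 1,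
   then A is inconsistent; if p(b, l) = 0, then A holds in a finite structure
   {0, ..., N} with truncated successor.  There are no function symbols, so unnesting
   is the identity. *)

(** * Substitution and natural deduction *)

Definition scons T (x : T) (s : nat -> T) (n : nat) : T :=
  if n is m.+1 then s m else x.

(** The arguments sit under a finite function, so the guarded [fix] descends into them to supply the
    hypotheses of the [App] case. *)
Lemma term_induction S (P : term S -> Prop) :
  (forall n, P (Var n)) ->
  (forall f (a : {ffun 'I_(far f) -> term S}), (forall i, P (a i)) -> P (App f a)) ->
  forall t, P t.
Proof.
move=> PV PA; fix IH 1; case=> [n|f a]; first exact: PV.
by apply: PA => i; apply: IH.
Qed.

Lemma subst_term_id S (t : term S) : subst_term Var t = t.
Proof.
elim/term_induction: t => //= f a IH; congr (App f _).
by apply/ffunP => i; rewrite ffunE.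
Qed.

Lemma eq_subst_form S (s s' : nat -> term S) : s =1 s' -> subst_form s =1 subst_form s'.
Proof. by move=> /funext ->. Qed.

Lemma subst_term_comp S (s s' : nat -> term S) t :
  subst_term s (subst_term s' t) = subst_term (fun n => subst_term s (s' n)) t.
Proof.
elim/term_induction: t => //= f a IH; congr (App f _).
by apply/ffunP => i; rewrite !ffunE.
Qed.

Lemma up_comp S (s s' : nat -> term S) n :
  subst_term (up s) (up s' n) = up (fun n => subst_term s (s' n)) n.
Proof. by case: n => //= n; rewrite !subst_term_comp. Qed.

Lemma subst_form_comp S (s s' : nat -> term S) phi :
  subst_form s (subst_form s' phi) = subst_form (fun n => subst_term s (s' n)) phi.
Proof.
elim: phi s s' => //= [t u|r a|f IHf g IHg|f IHf] s s'.
- by rewrite !subst_term_comp.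
- by congr (Rel r _); apply/ffunP => i; rewrite !ffunE subst_term_comp.
- by rewrite IHf IHg.
- by rewrite IHf (eq_subst_form (up_comp s s')).
Qed.

Lemma subst_bounded_term S n (s : nat -> term S) t :
  bounded_term n t -> (forall i, i < n -> s i = Var i) -> subst_term s t = t.
Proof.
move=> + sV; elim/term_induction: t => /= [m /sV //|f a IH a_n].
by congr (App f _); apply/ffunP => i; rewrite ffunE IH.
Qed.

Lemma subst_bounded_form S n (s : nat -> term S) phi :
  bounded n phi -> (forall i, i < n -> s i = Var i) -> subst_form s phi = phi.
Proof.
elim: phi n s => //= [t u|r a|f IHf g IHg|f IHf] n s.
- by move=> [tn un] sV; rewrite !(@subst_bounded_term _ n).
- by move=> an sV; congr (Rel r _); apply/ffunP => i; rewrite ffunE (@subst_bounded_term _ n).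
- by move=> [fn gn] sV; rewrite (IHf n) ?(IHg n).
- by move=> fn sV; rewrite (IHf n.+1) // => -[|i] //= /sV ->.
Qed.

Lemma subst_sentence S (s : nat -> term S) phi : sentence phi -> subst_form s phi = phi.
Proof. by move=> phi0; apply: subst_bounded_form phi0 _. Qed.

Lemma bounded_closure S n m (phi : form S) :
  bounded (n + m) phi -> bounded m (iter n (@All S) phi).
Proof. by elim: n m => //= n IH m nm; apply: IH; rewrite addnS. Qed.

Lemma weaken S (T T' : form S -> Prop) phi :
  proves T phi -> (forall psi, T psi -> T' psi) -> proves T' phi.
Proof.
move=> pf; elim: pf T' => {T phi} [T phi Tphi|T phi psi _ IH|T phi psi _ IH1 _ IH2
  |T phi _ IH|T phi _ IH|T phi t _ IH|T t|T phi t u _ IH1 _ IH2] T' sub.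
- exact/Ax/sub.
- by apply/ImpI/IH => chi [/sub|]; [left|right].
- by apply: ImpE (IH1 _ sub) (IH2 _ sub).
- by apply/Raa/IH => chi [/sub|]; [left|right].
- by apply/AllI/IH => chi [xi /sub Txi ->]; exists xi.
- exact/AllE/IH.
- exact: EqI.
- by apply: EqE (IH1 _ sub) (IH2 _ sub).
Qed.

Lemma exfalso S (T : form S -> Prop) phi : proves T Bot -> proves T phi.
Proof. by move=> pf; apply/Raa/(weaken pf) => psi; left. Qed.

Lemma topI S (T : form S -> Prop) : proves T Top.
Proof. by apply/ImpI/Ax; right. Qed.

Lemma impK S (T : form S -> Prop) phi psi : proves T psi -> proves T (Imp phi psi).
Proof. by move=> pf; apply/ImpI/(weaken pf) => chi; left. Qed.

Lemma negI_imp S (T : form S -> Prop) phi psi :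
  proves T phi -> proves T (Neg psi) -> proves T (Neg (Imp phi psi)).
Proof.
move=> p1 p2; apply/ImpI/(@ImpE _ _ psi).
  by apply: weaken p2 _; left.
apply: (@ImpE _ _ phi); first by apply: Ax; right.
by apply: weaken p1 _; left.
Qed.

Lemma imp_contra S (T : form S -> Prop) phi psi :
  proves T (Neg phi) -> proves T (Imp phi psi).
Proof.
move=> pf; apply/ImpI/exfalso/(@ImpE _ _ phi); last by apply: Ax; right.
by apply: weaken pf _; left.
Qed.

Lemma negNI S (T : form S -> Prop) phi : proves T phi -> proves T (Neg (Neg phi)).
Proof.
move=> pf; apply: ImpI; apply: (@ImpE _ _ phi); first by apply: Ax; right.
by apply: weaken pf _; left.
Qed.

Lemma andI S (T : form S -> Prop) phi psi :
  proves T phi -> proves T psi -> proves T (And phi psi).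
Proof. by move=> p1 p2; apply: negI_imp p1 (negNI p2). Qed.

Lemma exI S (T : form S -> Prop) t phi : proves T (inst t phi) -> proves T (Ex phi).
Proof.
move=> pf; apply/ImpI/(@ImpE _ _ (inst t phi)); last by apply: weaken pf _; left.
by apply: (@AllE _ _ (Neg phi) t); apply: Ax; right.
Qed.

(** [Bot] is its own shift, so the second premise yields [All (Neg phi)] by [AllI], which
    contradicts [Ex phi]. *)
Lemma exE_bot S (T : form S -> Prop) phi :
  proves T (Ex phi) ->
  proves (extend (fun psi => exists2 chi, T chi & psi = shift chi) phi) Bot ->
  proves T Bot.
Proof. by move=> ex pf; apply: ImpE ex _; apply/AllI/ImpI. Qed.

Lemma conjI S (T : form S -> Prop) (I : eqType) (s : seq I) (F : I -> form S) :
  (forall i, i \in s -> proves T (F i)) -> proves T (Conj [seq F i | i <- s]).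
Proof.
elim: s => [|i s IH] pf; first exact: topI.
apply: andI; first by apply: pf; rewrite mem_head.
by apply: IH => j js; apply: pf; rewrite inE js orbT.
Qed.

Lemma conjN S (T : form S -> Prop) (I : eqType) (s : seq I) (F : I -> form S) i :
  i \in s -> proves T (Neg (F i)) -> proves T (Neg (Conj [seq F i | i <- s])).
Proof.
move=> + pf; elim: s => //= j s IH; rewrite inE => /orP[/eqP<-|/IH pfs].
  exact/negNI/imp_contra.
exact/negNI/impK.
Qed.

(** Keeps successive instantiations as a single pending substitution: [up s] followed by [inst t]
    amounts to [scons t s]. *)
Lemma allE_subst S (T : form S -> Prop) s t phi :
  proves T (subst_form s (All phi)) -> proves T (subst_form (scons t s) phi).
Proof.
move=> /(@AllE _ _ _ t); rewrite /inst subst_form_comp.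
rewrite (@eq_subst_form _ _ (scons t s)) // => -[|n] //=.
by rewrite subst_term_comp subst_term_id.
Qed.

Lemma allE_closure S (T : form S -> Prop) n phi s :
  bounded n phi -> proves T (iter n (@All S) phi) -> proves T (subst_form s phi).
Proof.
elim: n phi s => [|n IH] phi s; first by move=> /(@subst_sentence _ s) ->.
(* The innermost quantifier is split off; the outer ones receive the values of [s] from 1 on. *)
move=> phin; rewrite iterSr => /(IH (All phi) (fun i => s i.+1) phin).
move=> /(@allE_subst _ _ _ (s 0)).
by rewrite (@eq_subst_form _ _ s) // => -[].
Qed.

(** * Horn clauses for the graph of a partial recursive function *)

Fixpoint bounded_prec (f g : seq nat -> nat -> Prop) (xs : seq nat) (k z : nat) : Prop :=
  if k is j.+1 then
    exists2 y, bounded_prec f g xs j y & g [:: j, y & xs] z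
  else f xs z.

(* [eval] with all the intermediate values and all the counters below [N]. *)
Fixpoint bounded_eval (N : nat) n (p : recf n) (xs : seq nat) (z : nat) : Prop :=
  z < N /\
  match p with
  | Zero _ => z = 0
  | Succ => z = (head 0 xs).+1
  | Proj _ i => z = nth 0 xs i
  | Comp m _ f gs =>
      exists2 ys : seq nat,
        size ys = m /\ (forall i : 'I_m, bounded_eval N (gs i) xs (nth 0 ys i)) &
        bounded_eval N f ys z
  | Prec _ f g =>
      head 0 xs < N /\
      bounded_prec (bounded_eval N f) (bounded_eval N g) (behead xs) (head 0 xs) z
  | Mu _ f =>
      bounded_eval N f (z :: xs) 0 /\
      forall j, j < z -> exists y, bounded_eval N f (j :: xs) y.+1
  end.

Lemma bounded_eval_lt N n (p : recf n) xs z : bounded_eval N p xs z -> z < N.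
Proof. by case: p => [?||??|????|???|??] []. Qed.

Lemma bounded_prec_mono (f g f' g' : seq nat -> nat -> Prop) xs k z :
  (forall ys y, f ys y -> f' ys y) -> (forall ys y, g ys y -> g' ys y) ->
  bounded_prec f g xs k z -> bounded_prec f' g' xs k z.
Proof.
move=> ff' gg'; elim: k z => [|k IH] z /=; first exact: ff'.
by move=> [y /IH ? /gg' ?]; exists y.
Qed.

Lemma bounded_prec_lt N (f g : seq nat -> nat -> Prop) xs k z :
  (forall ys y, f ys y -> y < N) -> (forall ys y, g ys y -> y < N) ->
  bounded_prec f g xs k z -> z < N.
Proof. by move=> fN gN; case: k => [/fN|k [y _ /gN]]. Qed.

Lemma bounded_eval_mono N N' n (p : recf n) xs z :
  N <= N' -> bounded_eval N p xs z -> bounded_eval N' p xs z.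
Proof.
move=> leN; elim: p xs z => {n} [n||n i|m n f IHf gs IHg|n f IHf g IHg|n f IHf] xs z /=
  [/leq_trans/(_ leN) zN' H]; split=> //.
- case: H => ys [szys gsP] /IHf fP; exists ys => //; split=> // i.
  exact/IHg.
- case: H => kN pf; split; first exact: leq_trans leN.
  by apply: bounded_prec_mono pf.
- by case: H => /IHf f0 fP; split=> // j /fP[y /IHf]; exists y.
Qed.

(** The maximum of the bounds works; this serves the components of a composition and the values
    below a minimum. *)
Lemma uniform_bound (I : finType) (P : I -> nat -> Prop) :
  (forall i N N', N <= N' -> P i N -> P i N') ->
  (forall i, exists N, P i N) -> exists N, forall i, P i N.
Proof.
move=> mono /fin_all_exists[N NP]; exists (\max_i N i) => i.
exact: mono (leq_bigmax i) (NP i).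
Qed.

(** A converging computation passes through finitely many values and counters, so some [N] exceeds
    them all. *)
Lemma eval_bounded n (p : recf n) xs z :
  eval p xs z -> exists N, bounded_eval N p xs z.
Proof.
elim: p xs z => {n} [n||n i|m n f IHf gs IHg|n f IHf g IHg|n f IHf] xs z /=.
- by move=> ->; exists 1.
- by move=> ->; exists (head 0 xs).+2; rewrite -[thead xs]/(tnth xs ord0) (tnth_nth 0) nth0.
- by move=> ->; exists (nth 0 xs i).+1; rewrite (tnth_nth 0).
- move=> [ys gsP /IHf[Nf fP]].
  have [||Ng NgP] := @uniform_bound _ (fun i N => bounded_eval N (gs i) xs (tnth ys i)).
  + by move=> i N N'; apply: bounded_eval_mono.
  + by move=> i; apply: IHg.
  exists (maxn Nf Ng); split.
    by apply: leq_trans (leq_maxl _ _); apply: bounded_eval_lt fP.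
  exists (tval ys); last by apply: bounded_eval_mono fP; apply: leq_maxl.
  split=> [|i]; first exact: size_tuple.
  by rewrite -tnth_nth; apply: bounded_eval_mono (NgP i); apply: leq_maxr.
- have -> : thead xs = head 0 xs by rewrite -nth0 -[thead xs]/(tnth xs ord0) (tnth_nth 0).
  pose ys : n.-tuple nat := [tuple of behead xs].
  change (prec_graph (eval f) (eval g) ys (head 0 xs) z -> exists N,
    z < N /\ (head 0 xs < N /\
      bounded_prec (bounded_eval N f) (bounded_eval N g) ys (head 0 xs) z)).
  move: ys (head 0 xs) => {xs} ys k.
  pose R N := bounded_prec (bounded_eval N f) (bounded_eval N g) ys.
  have R_mono N N' j y : N <= N' -> R N j y -> R N' j y.
    by move=> leN; apply: bounded_prec_mono => ? ?; apply: bounded_eval_mono.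
  suff H : prec_graph (eval f) (eval g) ys k z -> exists N, R N k z.
    (* The bound must also exceed the result [z] and the counter [k]. *)
    move=> /H[N NP]; exists (maxn N (maxn z k).+1).
    by split; [lia | split; [lia|]]; apply: R_mono NP; lia.
  elim: k z => [|k IH] z; first exact: IHf.
  move=> [y /IH[N NP] /(IHg [tuple of k :: y :: ys])[N' N'P]].
  exists (maxn N N'); exists y; first by apply: R_mono NP; lia.
  by apply: bounded_eval_mono N'P; lia.
- move=> [/(IHf [tuple of z :: xs])[N0 fP0] fP].
  have [||N NP] := @uniform_bound 'I_z
      (fun j N => exists y, bounded_eval N f ((j : nat) :: xs) y.+1).
  + by move=> i N N' leN [y yP]; exists y; apply: bounded_eval_mono yP.
  + by move=> [j /= /fP[y /(IHf [tuple of j :: xs])[N NP]]]; exists N, y.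
  have leN : N <= maxn (maxn N0 N) z.+1 by lia.
  have leN0 : N0 <= maxn (maxn N0 N) z.+1 by lia.
  exists (maxn (maxn N0 N) z.+1); split; first lia.
  split; first exact: bounded_eval_mono fP0.
  move=> j jz; have [y yP] := NP (Ordinal jz).
  by exists y; apply: bounded_eval_mono yP.
Qed.

(** * Horn clauses and their truncated models *)

Inductive symbol : Type :=
| IsZero
| IsSucc
| Value n of recf n
| Positive n of recf n.+1.

(** A [recf] stores functions on ordinals, so equality of symbols is decided classically. *)
HB.instance Definition _ := gen_eqMixin symbol.

Definition arity (s : symbol) : nat :=
  match s with IsZero => 1 | IsSucc => 2 | @Value n _ => n.+1 | @Positive n _ => n.+1 end.

Definition atom : Type := symbol * seq nat.

Definition well_formed (a : atom) : bool := size a.2 == arity a.1.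

Definition clause : Type := seq atom * atom.

(* [Value p] holds of z :: xs when p(xs) = z, and [Positive f] of z :: xs when
   f(j, xs) > 0 for all j < z. *)
Fixpoint clauses n (p : recf n) : seq clause :=
  match p with
  | Zero n =>
      [:: ([:: (IsZero, [:: n])], (Value (Zero n), n :: iota 0 n))]
  | Succ => [:: ([:: (IsSucc, [:: 0; 1])], (Value Succ, [:: 1; 0]))]
  | @Proj n i => [:: ([::], (Value (Proj i), nat_of_ord i :: iota 0 n))]
  | @Comp m n f gs =>
      (rcons [seq (Value (gs i), n + i :: iota 0 n) | i <- enum 'I_m]
         (Value f, n + m :: iota n m),
       (Value (Comp f gs), n + m :: iota 0 n)) ::
      clauses f ++ flatten [seq clauses (gs i) | i <- enum 'I_m]
  | @Prec n f g =>
      [:: ([:: (IsZero, [:: n]); (Value f, n.+2 :: iota 0 n)],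
           (Value (Prec f g), [:: n.+2, n & iota 0 n]));
          ([:: (IsSucc, [:: n; n.+3]);
               (Value (Prec f g), [:: n.+1, n & iota 0 n]);
               (Value g, [:: n.+2, n, n.+1 & iota 0 n])],
           (Value (Prec f g), [:: n.+2, n.+3 & iota 0 n]))] ++
      clauses f ++ clauses g
  | @Mu n f =>
      [:: ([:: (IsZero, [:: n])], (Positive f, n :: iota 0 n));
          ([:: (Positive f, n :: iota 0 n);
               (Value f, [:: n.+2, n & iota 0 n]);
               (IsSucc, [:: n.+1; n.+2]); (IsSucc, [:: n; n.+3])],
           (Positive f, n.+3 :: iota 0 n));
          ([:: (Positive f, n :: iota 0 n);
               (Value f, [:: n.+1, n & iota 0 n]); (IsZero, [:: n.+1])],
           (Value (Mu f), n :: iota 0 n))] ++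
      clauses f
  end.

(** [I] is kept abstract because it stands both for truth in the truncated model and for
    derivability at named numbers. *)
Definition closed_under (N : nat) (I : symbol -> seq nat -> Prop) (c : clause) : Prop :=
  forall s : nat -> nat, (forall i, s i <= N) ->
    (forall a : atom, a \in c.1 -> I a.1 (map s a.2)) -> I c.2.1 (map s c.2.2).

(* The number N stands for all the numbers from N on.  Where the bounded evaluation
   diverges any value is accepted, which makes the clauses true. *)
Definition truncation (N : nat) (s : symbol) (xs : seq nat) : Prop :=
  match s with
  | IsZero => head 0 xs = 0
  | IsSucc => nth 0 xs 1 = minn (nth 0 xs 0).+1 N
  | Value _ p => forall z, bounded_eval N p (behead xs) z -> head 0 xs = z
  | Positive _ f => forall j, j < head 0 xs -> ~ bounded_eval N f (j :: behead xs) 0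
  end.

Lemma clauses_wf n (p : recf n) c : c \in clauses p ->
  well_formed c.2 /\ forall a, a \in c.1 -> well_formed a.
Proof.
elim: p c => {n} [n||n i|m n f IHf gs IHg|n f IHf g IHg|n f IHf] c; rewrite ?inE /=.
- by move=> /eqP->; rewrite /well_formed /= size_iota; split=> // a; rewrite inE => /eqP->.
- by move=> /eqP->; split=> // a; rewrite inE => /eqP->.
- by move=> /eqP->; rewrite /well_formed /= size_iota.
- case/orP => [/eqP->|].
    rewrite /well_formed /= size_iota; split=> // a; rewrite mem_rcons inE.
    case/orP => [/eqP->|/mapP[i _ ->]] /=; by rewrite size_iota.
  rewrite mem_cat => /orP[/IHf //|/flattenP[s /mapP[i _ ->]]]; exact: IHg.
- rewrite mem_cat => /or4P[/eqP->|/eqP->|/IHf //|/IHg //];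
    rewrite /well_formed /= size_iota; split=> // a; rewrite !inE.
  + by case/orP => /eqP-> /=; rewrite ?size_iota.
  + by case/or3P => /eqP-> /=; rewrite ?size_iota.
- case/or4P => [/eqP->|/eqP->|/eqP->|/IHf //];
    rewrite /well_formed /= size_iota; split=> // a; rewrite !inE.
  + by move/eqP ->.
  + by case/or4P => /eqP-> /=; rewrite ?size_iota.
  + by case/or3P => /eqP-> /=; rewrite ?size_iota.
Qed.

(** A [Value] atom claims something only where the bounded evaluation converges; the values and
    counters involved are then below [N], where the truncated successor is the true one. *)
Lemma truncation_closed N n (p : recf n) c :
  0 < N -> c \in clauses p -> closed_under N (truncation N) c.
Proof.
move=> N0.
elim: p c => {n} [n||n i|m n f IHf gs IHg|n f IHf g IHg|n f IHf] c; rewrite ?inE /=.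
- move=> /eqP-> s sN /(_ _ (mem_head _ _)) /= s0 z [_ ->].
  by [].
- move=> /eqP-> s sN /(_ _ (mem_head _ _)) /= sS z [zN zE]; lia.
- move=> /eqP-> s sN _ z /= [_ ->].
  by rewrite (nth_map 0) ?size_iota // nth_iota.
- rewrite mem_cat => /or3P[/eqP->|/IHf //|/flattenP[cs /mapP[i _ ->]]]; last exact: IHg.
  move=> s sN H z /= [_ [ys [szys gsP] fP]].
  (* The premises on the [gs i] force the variables from [n] on to take the intermediate values. *)
  have ysE : ys = map s (iota n m).
    apply: (@eq_from_nth _ 0); first by rewrite size_map size_iota.
    move=> i; rewrite szys => im.
    rewrite (nth_map 0) ?size_iota // nth_iota //; apply/esym.
    have := H (Value (gs (Ordinal im)), n + i :: iota 0 n); apply.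
      by rewrite mem_rcons inE; apply/orP; right; apply/mapP; exists (Ordinal im); rewrite ?mem_enum.
    exact: (gsP (Ordinal im)).
  rewrite ysE in fP; have := H (Value f, n + m :: iota n m); apply => //.
  by rewrite mem_rcons mem_head.
- rewrite mem_cat => /or4P[/eqP->|/eqP->|/IHf //|/IHg //] s sN H z /= [_ [kN]].
  + have /= -> := H _ (mem_head _ _).
    have := H (Value f, n.+2 :: iota 0 n); apply.
    by rewrite !inE eqxx orbT.
  + have /= sS := H _ (mem_head _ _).
    (* The new counter is below [N] by [kN], so the truncation in [sS] has no effect. *)
    have -> : s n.+3 = (s n).+1 by lia.
    move=> [y yP zP].
    have /= sy := H (Value (Prec f g), [:: n.+1, n & iota 0 n]).
    have /= sz := H (Value g, [:: n.+2, n, n.+1 & iota 0 n]).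
    apply: sz; first by rewrite !inE eqxx !orbT.
    rewrite (sy _ y) //; first by rewrite !inE eqxx !orbT.
    by split; [apply: bounded_prec_lt yP; apply: bounded_eval_lt | split=> //; lia].
- case/or4P => [/eqP->|/eqP->|/eqP->|/IHf //] s sN H /=.
  + by have /= -> := H _ (mem_head _ _).
  + have /= HP := H (Positive f, n :: iota 0 n).
    have /= Hf := H (Value f, [:: n.+2, n & iota 0 n]).
    have /= HS := H (IsSucc, [:: n.+1; n.+2]).
    have /= -> := H (IsSucc, [:: n; n.+3]); last by rewrite !inE eqxx !orbT.
    move=> j; rewrite leq_min ltnS => /andP[+ _]; rewrite leq_eqVlt => /orP[/eqP-> f0|jn].
      (* If [f] took the value 0 at [s n], then [s n.+2] would be 0; but it is a truncated
         successor, positive since [0 < N]. *)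
      have sf0 : s n.+2 = 0 by apply: Hf f0; rewrite !inE eqxx !orbT.
      by have := HS; rewrite !inE eqxx !orbT sf0 => /(_ isT); lia.
    by apply: HP jn; rewrite mem_head.
  + have /= HP := H (Positive f, n :: iota 0 n).
    have /= Hf := H (Value f, [:: n.+1, n & iota 0 n]).
    have /= H0 := H (IsZero, [:: n.+1]).
    move=> z [_ [f0 fS]]; apply/eqP; rewrite eqn_leq; apply/andP; split; rewrite leqNgt.
      by apply/negP => zs; apply: HP f0; rewrite // mem_head.
    apply/negP => /fS[y /Hf]; rewrite H0 ?inE ?eqxx ?orbT // => /(_ isT) //.
Qed.

(** The computation is replayed inside [I]: each step is an instance of a clause at values that are
    at most [N]. *)
Lemma closed_value N (I : symbol -> seq nat -> Prop) n (p : recf n) :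
  (forall c, c \in clauses p -> closed_under N I c) ->
  I IsZero [:: 0] -> (forall i, i < N -> I IsSucc [:: i; i.+1]) ->
  forall xs z, size xs = n -> all (fun x => x <= N) xs ->
    bounded_eval N p xs z -> I (Value p) (z :: xs).
Proof.
move=> + I0 IS.
(* The valuations below are of the form [nth 0 (xs ++ ys)], parameters first and then the other
   variables; the default 0 is also at most [N]. *)
have bnd ys i : all (fun x => x <= N) ys -> nth 0 ys i <= N.
  move=> /allP ysN; case: (ltnP i (size ys)) => [/(mem_nth 0)/ysN //|szi].
  by rewrite nth_default.
have vars ys zs : [seq nth 0 (ys ++ zs) i | i <- iota 0 (size ys)] = ys.
  by rewrite map_nth_iota0 ?size_cat ?leq_addr // take_size_cat.
have at_ ys zs i : nth 0 (ys ++ zs) (i + size ys) = nth 0 zs i.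
  by rewrite nth_cat ltnNge leq_addl addnK.
have H_ k (q : recf k) i : (forall c, c \in clauses q -> closed_under N I c) ->
    i < size (clauses q) -> closed_under N I (nth ([::], (IsZero, [::])) (clauses q) i).
  by move=> H ic; apply/H/mem_nth.
elim: p => {n} [n||n i|m n f IHf gs IHg|n f IHf g IHg|n f IHf] H xs z sz xsN pf;
  have /ltnW zN := bounded_eval_lt pf; move: pf => /= [zN'].
- move=> z0; have := H _ (mem_head _ _) (nth 0 (xs ++ [:: z])).
  rewrite /= -sz vars nth_cat ltnn subnn z0; apply.
    by move=> i; apply: bnd; rewrite all_cat xsN.
  by move=> a; rewrite inE => /eqP-> /=; rewrite nth_cat ltnn subnn.
- case: xs sz xsN => [|x []] //= _ /andP[xN _] zE.
  have := H _ (mem_head _ _) (nth 0 [:: x; z]); apply.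
    by move=> i; apply: bnd; rewrite /= xN zN.
  by move=> a; rewrite inE => /eqP-> /=; rewrite zE; apply: IS; lia.
- subst n; move=> ->; have := H _ (mem_head _ _) (nth 0 (xs ++ [::])).
  rewrite /= vars cats0; apply => // j; exact: bnd.
- subst n; move=> [ys [szys gsP] fP]; subst m.
  have ysN : all (fun x => x <= N) ys.
    apply/allP => y /(nthP 0)[i im <-]; apply: ltnW.
    exact: bounded_eval_lt (gsP (Ordinal im)).
  have := H _ (mem_head _ _) (nth 0 (xs ++ ys ++ [:: z])).
  rewrite /= vars nth_cat ltnNge leq_addr addKn nth_cat ltnn subnn /=; apply.
    by move=> i; apply: bnd; rewrite !all_cat xsN ysN /= zN.
  move=> a; rewrite mem_rcons inE => /orP[/eqP->|/mapP[i _ ->]] /=.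
    rewrite nth_cat ltnNge leq_addr addKn nth_cat ltnn subnn /=.
    rewrite map_nth_iota; last by rewrite !size_cat addKn leq_addr.
    rewrite drop_size_cat // take_size_cat //.
    by apply: IHf fP => // c cf; apply: H; rewrite inE mem_cat cf orbT.
  rewrite vars nth_cat ltnNge leq_addr addKn nth_cat ltn_ord.
  apply: IHg (gsP i) => // c cg; apply: H; rewrite inE mem_cat; apply/orP; right.
  by apply/orP; right; apply/flattenP; exists (clauses (gs i)); rewrite ?map_f ?mem_enum.
- case: xs sz xsN => [|k xs] //= [sz] /andP[kN xsN] [kN' pf]; subst n.
  elim: k z pf zN zN' kN' {kN} => [|k IH] z /= pf zN zN' kN.
    have := H_ _ _ 0 H isT (nth 0 (xs ++ [:: 0; 0; z])).
    rewrite /= vars !(at_ xs _ 0, at_ xs _ 2) /=; apply.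
      by move=> i; apply: bnd; rewrite all_cat xsN /= zN.
    move=> a; rewrite !inE => /orP[]/eqP-> /=; rewrite ?vars !(at_ xs _ 0, at_ xs _ 2) //=.
    by apply: IHf => // c cf; apply: H; rewrite !inE mem_cat cf !orbT.
  case: pf => y yP gP.
  have yN : y < N by apply: bounded_prec_lt yP; apply: bounded_eval_lt.
  (* After the parameters come the counter, the previous value, the result and the next counter. *)
  have := H_ _ _ 1 H isT (nth 0 (xs ++ [:: k; y; z; k.+1])).
  rewrite /= vars !(at_ xs _ 2, at_ xs _ 3) /=; apply.
    by move=> i; apply: bnd; rewrite all_cat xsN /=; lia.
  move=> a; rewrite !inE => /or3P[]/eqP-> /=;
    rewrite ?vars !(at_ xs _ 0, at_ xs _ 1, at_ xs _ 2, at_ xs _ 3) /=.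
  + by apply: IS; apply: ltnW.
  + by apply: IH => //; apply: ltnW.
  + apply: IHg => //=; last by rewrite xsN; lia.
    by move=> c cf; apply: H; rewrite !inE mem_cat cf !orbT.
- subst n; case=> f0 fS.
  have sub c : c \in clauses f -> closed_under N I c.
    by move=> cf; apply: H; rewrite !inE cf !orbT.
  have pos j : j <= z -> I (Positive f) (j :: xs).
    elim: j => [|j IH] jz.
      have := H_ _ _ 0 H isT (nth 0 (xs ++ [:: 0])).
      rewrite /= vars (at_ xs _ 0) /=; apply.
        by move=> i; apply: bnd; rewrite all_cat xsN.
      by move=> a; rewrite inE => /eqP-> /=; rewrite (at_ xs _ 0).
    have [y yP] := fS _ jz; have yN := bounded_eval_lt yP.
    (* The value [y.+1] of [f] is given with its predecessor; [j < z < N] and [y.+1 < N] bring both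
       successors within reach of [IS]. *)
    have := H_ _ _ 1 H isT (nth 0 (xs ++ [:: j; y; y.+1; j.+1])).
    rewrite /= vars !(at_ xs _ 3) /=; apply.
      by move=> i; apply: bnd; rewrite all_cat xsN /=; lia.
    move=> a; rewrite !inE => /or4P[]/eqP-> /=;
      rewrite ?vars !(at_ xs _ 0, at_ xs _ 1, at_ xs _ 2, at_ xs _ 3) /=.
    + by apply: IH; apply: ltnW.
    + by apply: IHf => //=; rewrite xsN; lia.
    + by apply: IS; lia.
    + by apply: IS; lia.
  have := H_ _ _ 2 H isT (nth 0 (xs ++ [:: z; 0])).
  rewrite /= vars !(at_ xs _ 0) /=; apply.
    by move=> i; apply: bnd; rewrite all_cat xsN /= zN.
  move=> a; rewrite !inE => /or3P[]/eqP-> /=; rewrite ?vars ?(at_ xs _ 0, at_ xs _ 1) //=.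
  + exact: pos.
  + by apply: IHf => //=; rewrite zN.
Qed.

(** * Computing codes of formulas *)

Definition computable n (f : n.-tuple nat -> nat) : Prop :=
  exists p : recf n, forall xs, eval p xs (f xs).

Lemma computable_proj n (i : 'I_n) : computable (fun xs => tnth xs i).
Proof. by exists (Proj i). Qed.

Lemma computable_comp m n (f : m.-tuple nat -> nat) (gs : 'I_m -> n.-tuple nat -> nat) :
  computable f -> (forall i, computable (gs i)) ->
  computable (fun xs => f [tuple gs i xs | i < m]).
Proof.
move=> [p pf] /fin_all_exists[q qg]; exists (Comp p q) => xs /=.
by exists [tuple gs i xs | i < m] => // i; rewrite tnth_mktuple.
Qed.

Lemma computable_comp1 n (f : 1.-tuple nat -> nat) (g : n.-tuple nat -> nat) :
  computable f -> computable g -> computable (fun xs => f [tuple g xs]).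
Proof.
move=> cf cg; have := computable_comp cf (fun _ : 'I_1 => cg).
congr computable; apply/funext => xs; congr f; apply: eq_from_tnth => i.
by rewrite tnth_mktuple ord1.
Qed.

Lemma computable_comp2 n (f : 2.-tuple nat -> nat) (g h : n.-tuple nat -> nat) :
  computable f -> computable g -> computable h ->
  computable (fun xs => f [tuple g xs; h xs]).
Proof.
move=> cf cg ch.
have := @computable_comp 2 n f (fun i => if i == ord0 then g else h) cf.
have cgh (i : 'I_2) : computable (if i == ord0 then g else h) by case: ifP.
move=> /(_ cgh); congr computable; apply/funext => xs; congr f; apply: eq_from_tnth => i.
by rewrite tnth_mktuple; case: i => -[|[]].
Qed.

Lemma computable_succ n (f : n.-tuple nat -> nat) :
  computable f -> computable (fun xs => (f xs).+1).
Proof. by apply: (@computable_comp1 _ (fun xs => (thead xs).+1)); exists Succ. Qed.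

Lemma computable_const n c : computable (fun _ : n.-tuple nat => c).
Proof. by elim: c => [|c]; [exists (Zero n) | apply: computable_succ]. Qed.

Lemma computable_recursive n h (f : n.-tuple nat -> nat) :
  recursive h -> computable f -> computable (fun xs => h (f xs)).
Proof.
case=> p ph; apply: (@computable_comp1 _ (fun xs => h (thead xs))).
exists p => xs; rewrite {1}(_ : xs = [tuple thead xs]); first exact: ph.
by apply: eq_from_tnth => i; rewrite ord1.
Qed.

Lemma computable_iter n (f : n.-tuple nat -> nat) (g : nat -> nat) :
  computable f -> recursive g ->
  computable (fun xs : n.+1.-tuple nat => iter (thead xs) g (f [tuple of behead xs])).
Proof.
move=> [p pf] rg.
(* The step function of [Prec] receives the counter at index 0 and the previous value at index 1,
   which [lift ord0 ord0] selects. *)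
have [q qg] := computable_recursive rg (computable_proj (lift ord0 ord0 : 'I_n.+2)).
exists (Prec p q) => xs /=; elim: (thead xs) => //= k IH.
exists (iter k g (f [tuple of behead xs])); first exact: IH.
exact: (qg [tuple of k :: _ :: [tuple of behead xs]]).
Qed.

Lemma recursive_iter (g : nat -> nat) c : recursive g -> recursive (fun k => iter k g c).
Proof.
move=> rg; have [p pP] := computable_iter (computable_const 0 c) rg.
by exists p => x; apply: (pP [tuple x]).
Qed.

(** The cons step of [CodeSeq.code]; the empty list has code 0. *)
Definition ccons (n m : nat) : nat := 2 ^ n * m.*2.+1.

Lemma code_cons n s : CodeSeq.code (n :: s) = ccons n (CodeSeq.code s).
Proof. by []. Qed.

Lemma computable_ccons n (f g : n.-tuple nat -> nat) :
  computable f -> computable g -> computable (fun xs => ccons (f xs) (g xs)).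
Proof.
have dbl : recursive double.
  have [|p pP] := recursive_iter (g := fun x => x.+2) 0.
    have [p pP] := computable_succ (computable_succ (computable_proj (ord0 : 'I_1))).
    by exists p => x; apply: (pP [tuple x]).
  exists p => x; have -> : x.*2 = iter x (fun x => x.+2) 0 by elim: x => //= x <-.
  exact: pP.
have cc : computable (fun xs : 2.-tuple nat => ccons (tnth xs ord0) (tnth xs ord_max)).
  (* Multiplying by a power of 2 is iterated doubling. *)
  have [|p pP] := computable_iter (f := fun ys : 1.-tuple nat => (tnth ys ord0).*2.+1) _ dbl.
    by apply/computable_succ/computable_recursive/computable_proj.
  exists p => xs; have := pP xs; congr eval.
  have -> : tnth [tuple of behead xs] ord0 = tnth xs ord_max.
    by rewrite !(tnth_nth 0) nth_behead.
  rewrite /ccons -[thead xs]/(tnth xs ord0).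
  elim: (tnth xs ord0) => [|k IH]; first by rewrite mul1n.
  by rewrite iterS IH expnS -mulnA mul2n.
exact: computable_comp2 cc.
Qed.

(** These functions act on codes alone, so they are free of the signature and can be shown
    computable. *)
Definition code_imp (x y : nat) : nat := ccons 3 (ccons x (ccons y 0)).
Definition code_all (x : nat) : nat := ccons 4 (ccons x 0).
Definition code_neg (x : nat) : nat := code_imp x (ccons 0 0).
Definition code_and (x y : nat) : nat := code_neg (code_imp x (code_neg y)).
Definition code_ex (x : nat) : nat := code_neg (code_all (code_neg x)).
(* Locked, lest conversion evaluate an enormous unary number. *)
Definition code_rel (r : nat) (vs : seq nat) : nat :=
  locked CodeSeq.code [:: 2, r & [seq CodeSeq.code [:: 0; v] | v <- vs]].

Lemma code_Imp S (phi psi : form S) :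
  code_form (Imp phi psi) = code_imp (code_form phi) (code_form psi).
Proof. by []. Qed.

Lemma code_All S (phi : form S) : code_form (All phi) = code_all (code_form phi).
Proof. by []. Qed.

Lemma code_Neg S (phi : form S) : code_form (Neg phi) = code_neg (code_form phi).
Proof. by []. Qed.

Lemma code_And S (phi psi : form S) :
  code_form (And phi psi) = code_and (code_form phi) (code_form psi).
Proof. by []. Qed.

Lemma code_Ex S (phi : form S) : code_form (Ex phi) = code_ex (code_form phi).
Proof. by []. Qed.

Lemma computable_code_imp n (f g : n.-tuple nat -> nat) :
  computable f -> computable g -> computable (fun xs => code_imp (f xs) (g xs)).
Proof.
by move=> cf cg; do 3![apply: computable_ccons => //; try exact: computable_const].
Qed.

Lemma computable_code_all n (f : n.-tuple nat -> nat) :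
  computable f -> computable (fun xs => code_all (f xs)).
Proof.
by move=> cf; do 2![apply: computable_ccons => //; try exact: computable_const].
Qed.

Lemma computable_code_neg n (f : n.-tuple nat -> nat) :
  computable f -> computable (fun xs => code_neg (f xs)).
Proof. by move=> cf; apply: computable_code_imp => //; apply: computable_const. Qed.

Lemma computable_code_and n (f g : n.-tuple nat -> nat) :
  computable f -> computable g -> computable (fun xs => code_and (f xs) (g xs)).
Proof. by move=> cf cg; apply/computable_code_neg/computable_code_imp/computable_code_neg. Qed.

Lemma computable_code_ex n (f : n.-tuple nat -> nat) :
  computable f -> computable (fun xs => code_ex (f xs)).
Proof. by move=> cf; apply/computable_code_neg/computable_code_all/computable_code_neg. Qed.

(** Zero and successor are the relations 0 and 1 of every [lang p], so the code of a numeral does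
    not depend on [p]. *)
Definition code_numeral (k : nat) : nat :=
  iter k (fun x => code_ex (code_and x (code_rel 1 [:: 0; 1]))) (code_rel 0 [:: 0]).

Lemma recursive_code_numeral : recursive code_numeral.
Proof.
apply: recursive_iter.
have [|p pP] := @computable_code_ex 1 (fun xs => code_and (tnth xs ord0) (code_rel 1 [:: 0; 1])).
  by apply: computable_code_and; [apply: computable_proj | apply: computable_const].
by exists p => x; apply: (pP [tuple x]).
Qed.

(* The code of the sentence saying that the relation number 2 fails of (1, b, l). *)
Definition code_refutation (b l : nat) : nat :=
  code_all (code_imp (code_numeral b)
    (code_all (code_imp (code_numeral l)
      (code_all (code_imp (code_numeral 1) (code_neg (code_rel 2 [:: 0; 2; 1]))))))).

(** The leading 0 codes the empty list of function symbols, [b] the relation arities, and [l] the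
    axioms that follow the refutation. *)
Definition code_refutable (b l : nat) : nat :=
  ccons 0 (ccons b (ccons (ccons (code_refutation b l) l) 0)).

Lemma computable_code_refutable :
  computable (fun xs : 2.-tuple nat => code_refutable (tnth xs ord0) (tnth xs ord_max)).
Proof.
have c0 := computable_proj (ord0 : 'I_2).
have c1 := computable_proj (ord_max : 'I_2).
have num := computable_recursive recursive_code_numeral.
do 3!(apply: computable_ccons; try exact: computable_const) => //.
apply: computable_ccons => //.
do 3!(apply/computable_code_all/computable_code_imp; first by apply: num; try exact: computable_const).
exact: computable_const.
Qed.

Lemma code_term_inj S : injective (@code_term S).
Proof.
elim/term_induction => [n|f a IH] [m|g b] /(can_inj CodeSeq.codeK) // [].
  by move=> ->.
move=> /val_inj fg; subst g => ab; congr (App f _); apply/ffunP => i; apply: IH.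
by have /eq_in_map := ab; apply; rewrite mem_enum.
Qed.

Lemma code_form_inj S : injective (@code_form S).
Proof.
elim=> [|t u|r a|f IHf g IHg|f IHf] [|t' u'|r' a'|f' g'|f'] /(can_inj CodeSeq.codeK) // [].
- by move=> /code_term_inj -> /code_term_inj ->.
- move=> /val_inj rr; subst r' => ab; congr (Rel r _); apply/ffunP => i; apply: code_term_inj.
  by have /eq_in_map := ab; apply; rewrite mem_enum.
- by move=> /IHf -> /IHg ->.
- by move=> /IHf ->.
Qed.

(** * Finite models of relational theories as piecewise interpretations *)

Definition relational (ra : seq nat) : signature := Signature [::] ra.

Definition var_index S (t : term S) : nat := if t is Var n then n else 0.

Lemma relational_var ra (t : term (relational ra)) : t = Var (var_index t).
Proof. by case: t => // -[]. Qed.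

Definition structure ra (D : Type) : Type :=
  forall r : rsym (relational ra), {ffun 'I_(rar r) -> D} -> Prop.

Fixpoint sat ra D (M : structure ra D) (e : nat -> D) (phi : form (relational ra)) : Prop :=
  match phi with
  | Bot => False
  | Eq t u => e (var_index t) = e (var_index u)
  | Rel r a => M r [ffun i => e (var_index (a i))]
  | Imp phi psi => sat M e phi -> sat M e psi
  | All phi => forall d, sat M (scons d e) phi
  end.

Lemma sat_subst ra D (M : structure ra D) e s phi :
  sat M e (subst_form s phi) <-> sat M (fun n => e (var_index (s n))) phi.
Proof.
have sE (t : term (relational ra)) (e' : nat -> D) (s' : nat -> term (relational ra)) :
    e' (var_index (subst_term s' t)) = e' (var_index (s' (var_index t))).
  by rewrite [t]relational_var.
elim: phi e s => //= [t u|r a|f IHf g IHg|f IHf] e s.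
- by rewrite !sE.
- by rewrite (_ : [ffun i => _] = [ffun i => e (var_index (s (var_index (a i))))]) //;
    apply/ffunP => i; rewrite !ffunE sE.
- by rewrite IHf IHg.
- have upE d : (fun n => scons d e (var_index (up s n))) =
               scons d (fun n => e (var_index (s n))).
    by apply/funext => -[|n] //=; rewrite [s n]relational_var.
  by split=> H d; move: (H d); rewrite IHf upE.
Qed.

Lemma sat_And ra D (M : structure ra D) e phi psi :
  sat M e (And phi psi) <-> sat M e phi /\ sat M e psi.
Proof.
split=> /= [H|[Hf Hg] /(_ Hf)/(_ Hg) //].
by split; apply: contrapT => N; apply: H => // /N.
Qed.

Lemma sat_Ex ra D (M : structure ra D) e phi :
  sat M e (Ex phi) <-> exists d, sat M (scons d e) phi.
Proof.
split=> /= [H|[d Hd] /(_ d)/(_ Hd) //].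
by apply: contrapT => N; apply: H => d Hd; apply: N; exists d.
Qed.

Lemma soundness ra D (M : structure ra D) T phi e :
  proves T phi -> (forall psi, T psi -> sat M e psi) -> sat M e phi.
Proof.
move=> pf; elim: pf e => {T phi} [T phi Tphi|T phi psi _ IH|T phi psi _ IH1 _ IH2
  |T phi _ IH|T phi _ IH|T phi t _ IH|T t|T phi t u _ IH1 _ IH2] e MT //.
- exact: MT.
- by move=> Mphi; apply: IH => chi [/MT|->].
- exact: (IH1 e MT (IH2 e MT)).
- apply: contrapT => N; apply: (IH e) => chi [/MT|->] //.
- by move=> d; apply: IH => chi [xi /MT Mxi ->]; apply/sat_subst.
- apply/sat_subst; have /= := IH e MT (e (var_index t)).
  by congr sat; apply/funext => -[|n].
- move: (IH2 e MT) => /sat_subst H2; apply/sat_subst; move: H2.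
  by congr sat; apply/funext => -[|n] //=; rewrite (IH1 e MT).
Qed.

Lemma unnest_relational ra (phi : form (relational ra)) : unnest phi = phi.
Proof.
elim: phi => //= [t u|r a|f -> g ->|f ->] //.
  by rewrite [t]relational_var [u]relational_var /= addn0.
by rewrite ifT //; apply/forallP => i; rewrite [a i]relational_var.
Qed.

Definition truth S (P : Prop) : form S := if `[< P >] then Top else Bot.

Lemma truth_bounded S n P : bounded n (truth S P).
Proof. by rewrite /truth; case: ifP. Qed.

(* As pieces are elements of the model, atoms can be translated to their truth values. *)
Definition model_translation ra N (M : structure ra 'I_N.+1) S :
  translation (relational ra) S :=
  @Translation (relational ra) S N (fun _ => 1) (fun _ => Top)
    (fun p q => truth S (p = q)) (fun r ps => truth S (M r ps)) (fun _ _ _ => Bot)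
    (fun _ => isT) (fun _ => conj I I) (fun p q => truth_bounded _ _ _)
    (fun r ps => truth_bounded _ _ _) (fun _ _ _ => I).

(** Truth and falsity go together because implication exchanges them on its left. No axiom of [T] is
    used: pure logic decides the translations. *)
Lemma translate_model ra N (M : structure ra 'I_N.+1) S phi
    (e : nat -> value (model_translation M S)) :
  (sat M (fun n => (e n).1) phi -> forall T, proves T (translate e phi)) /\
  (~ sat M (fun n => (e n).1) phi -> forall T, proves T (Neg (translate e phi))).
Proof.
have truthP P xs : (P -> forall T, proves T (apply_vars (truth S P) xs)) /\
    (~ P -> forall T, proves T (Neg (apply_vars (truth S P) xs))).
  by rewrite /truth; split=> [/asboolT|/asboolF] -> T; apply: topI.
elim: phi e => [|t u|r a|f IHf g IHg|f IHf] e.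
- by split=> // _ T; apply: topI.
- rewrite [t]relational_var [u]relational_var; exact: truthP.
- suff E : [ffun i => (arg e (a i)).1] =
           [ffun i => (e (var_index (a i))).1] :> {ffun 'I_(rar r) -> 'I_N.+1}.
    by rewrite /= E; apply: truthP.
  by apply/ffunP => i; rewrite !ffunE [a i]relational_var.
- have [IHf1 IHf2] := IHf e; have [IHg1 IHg2] := IHg e; split=> /= H T.
    have [/H/IHg1 pf|/IHf2 pf] := pselect (sat M (fun n => (e n).1) f).
      exact: impK.
    exact: imp_contra.
  have [Mf /IHg2 Mg] : sat M (fun n => (e n).1) f /\ ~ sat M (fun n => (e n).1) g.
    by split; [apply: contrapT => N'; apply: H => /N' | move=> Mg; apply: H].
  exact/negI_imp/Mg/IHf1.
- have pushE (p : piece (model_translation M S)) : (fun n => (push p e n).1) = scons p (fun n => (e n).1).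
    by apply/funext => -[].
  split=> /= H T.
    apply: conjI => p _; apply/AllI/impK.
    by apply: (proj1 (IHf (push p e))); rewrite pushE.
  have [p Np] : exists p, ~ sat M (scons p (fun n => (e n).1)) f.
    by apply: contrapT => N'; apply: H => p; apply: contrapT => Np; apply: N'; exists p.
  apply: (@conjN _ _ _ _ _ p); first by rewrite mem_enum.
  apply: ImpI => /=; set psi := translate _ _.
  (* The hypothesis refutes [psi] in every theory, hence also in the shifted context; both universal
     formulas are then instantiated at the same term. *)
  have Npsi : proves (extend T (All (Imp Top psi))) (All (Neg psi)).
    by apply: AllI; apply: (proj2 (IHf (push p e))); rewrite pushE.
  apply: (ImpE (AllE (Var 0) Npsi)).
  by apply: (ImpE (AllE (phi := Imp Top psi) (Var 0) (Ax _))); [right | apply: topI].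
Qed.

Lemma finite_model_interprets ra N (M : structure ra 'I_N.+1) A S (T : form S -> Prop) :
  (forall e phi, A phi -> sat M e phi) -> interprets T A.
Proof.
move=> MA; exists (model_translation M S) => phi _ pf.
rewrite /translate_sentence unnest_relational.
exact: (proj1 (translate_model phi _)) (soundness pf (MA _)) _.
Qed.

(** * The finitely axiomatised theory of a computation *)

(** The first three symbols get the same indices for every [p], as the codes above require;
    repetitions are harmless, since [index] finds the first occurrence. *)
Definition used_symbols n (p : recf n) : seq symbol :=
  [:: IsZero, IsSucc, Value p
    & [seq a.1 | a <- flatten [seq rcons c.1 c.2 | c <- clauses p]]].

Definition lang n (p : recf n) : signature := relational (map arity (used_symbols p)).

Definition symbol_index n (p : recf n) (s : symbol) : rsym (lang p) :=
  inord (index s (used_symbols p)).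

(** For such atoms the symbol belongs to [lang p] and the list fills its places exactly, so no
    default value enters [atom_form]. *)
Definition admissible n (p : recf n) (a : atom) : bool :=
  well_formed a && (a.1 \in used_symbols p).

Definition atom_form n (p : recf n) (a : atom) : form (lang p) :=
  Rel (symbol_index p a.1) [ffun i : 'I_(rar (symbol_index p a.1)) => Var (nth 0 a.2 i)].

Lemma symbol_indexE n (p : recf n) s :
  s \in used_symbols p -> symbol_index p s = index s (used_symbols p) :> nat.
Proof.
move=> used; have lt_s : index s (used_symbols p) < size (map arity (used_symbols p)).
  by rewrite size_map index_mem.
by rewrite inordK.
Qed.

Lemma rar_symbol_index n (p : recf n) s :
  s \in used_symbols p -> rar (symbol_index p s) = arity s.
Proof.
by move=> used; rewrite /rar symbol_indexE // (nth_map IsZero) ?index_mem // nth_index.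
Qed.

Lemma rar_atom n (p : recf n) a :
  admissible p a -> rar (symbol_index p a.1) = size a.2.
Proof. by move=> /andP[/eqP-> /rar_symbol_index]. Qed.

Lemma admissible_clauses n (p : recf n) c :
  c \in clauses p -> admissible p c.2 /\ forall a, a \in c.1 -> admissible p a.
Proof.
move=> cp; have [wf2 wf1] := clauses_wf cp.
have used a : a \in rcons c.1 c.2 -> a.1 \in used_symbols p.
  move=> ac; rewrite !inE; do 3!(apply/orP; right).
  by apply/map_f/flattenP; exists (rcons c.1 c.2) => //; apply/mapP; exists c.
split=> [|a ac]; apply/andP; split=> //; try exact: wf1; apply: used.
  by rewrite mem_rcons mem_head.
by rewrite mem_rcons inE ac orbT.
Qed.

Lemma subst_atom n (p : recf n) a s f :
  admissible p a -> (forall v, v \in a.2 -> s v = Var (f v)) ->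
  subst_form s (atom_form p a) = atom_form p (a.1, map f a.2).
Proof.
move=> adm sf; congr Rel; apply/ffunP => i; rewrite !ffunE /=.
have lt_i : i < size a.2 by rewrite -(rar_atom adm).
by rewrite (nth_map 0) // sf // mem_nth.
Qed.

Lemma bounded_atom n (p : recf n) a m :
  admissible p a -> (forall v, v \in a.2 -> v < m) -> bounded m (atom_form p a).
Proof. by move=> adm lt_m i; rewrite ffunE; apply/lt_m/mem_nth; rewrite -(rar_atom adm). Qed.

Lemma map_enum_nth T (f : nat -> T) (vs : seq nat) k :
  k = size vs -> [seq f (nth 0 vs i) | i : 'I_k <- enum 'I_k] = map f vs.
Proof.
move=> ->; rewrite -[RHS](congr1 (map f) (take_size _)) -(map_nth_iota0 0) //.
by rewrite -map_comp -val_enum_ord -map_comp.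
Qed.

Lemma code_atom n (p : recf n) a :
  admissible p a ->
  code_form (atom_form p a) = code_rel (index a.1 (used_symbols p)) a.2.
Proof.
move=> adm; have /andP[_ /symbol_indexE idx] := adm.
rewrite /code_rel -lock -idx -(map_enum_nth _ (rar_atom adm)) /atom_form.
set r := symbol_index p a.1; congr (CodeSeq.code [:: 2, nat_of_ord r & _]).
by apply: eq_map => i; rewrite ffunE.
Qed.

Definition truncated n (p : recf n) N :
    structure (map arity (used_symbols p)) 'I_N.+1 :=
  fun r xs => truncation N (nth IsZero (used_symbols p) r) [seq val (xs i) | i <- enum 'I_(rar r)].

Arguments truncated {n} p N.

Lemma sat_atom n (p : recf n) N e a :
  admissible p a ->
  sat (truncated p N) e (atom_form p a) <-> truncation N a.1 [seq val (e v) | v <- a.2].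
Proof.
move=> adm; have /andP[_ used] := adm.
rewrite /= /truncated symbol_indexE // nth_index //.
rewrite -(map_enum_nth _ (rar_atom adm)).
by under eq_map => i do rewrite !ffunE.
Qed.

Definition clause_matrix n (p : recf n) (c : clause) : form (lang p) :=
  foldr (fun a phi => Imp (atom_form p a) phi) (atom_form p c.2) c.1.

Definition clause_bound (c : clause) : nat :=
  (\max_(v <- flatten [seq a.2 | a <- c.2 :: c.1]) v).+1.

Definition clause_form n (p : recf n) (c : clause) : form (lang p) :=
  iter (clause_bound c) (@All _) (clause_matrix p c).

Lemma clause_bound_gt c (a : atom) v : a \in c.2 :: c.1 -> v \in a.2 -> v < clause_bound c.
Proof.
move=> ac va; rewrite ltnS; apply: (@leq_bigmax_seq _ _ xpredT id) => //.
by apply/flattenP; exists a.2 => //; apply: map_f.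
Qed.

Lemma bounded_clause n (p : recf n) c :
  c \in clauses p -> bounded (clause_bound c) (clause_matrix p c).
Proof.
move=> /admissible_clauses[adm2 adm1]; rewrite /clause_matrix.
have : forall a, a \in c.1 -> bounded (clause_bound c) (atom_form p a).
  move=> a ac; apply: bounded_atom => [|v]; first exact: adm1.
  by apply: clause_bound_gt; rewrite inE ac orbT.
have : bounded (clause_bound c) (atom_form p c.2).
  by apply: bounded_atom => // v; apply: clause_bound_gt; rewrite mem_head.
move: (clause_bound c) c.2 => m a2 b2; elim: c.1 => // a s IH b1; split.
  by apply: b1; rewrite mem_head.
by apply: IH => a' a's; apply: b1; rewrite inE a's orbT.
Qed.

Lemma sat_clause n (p : recf n) N e c :
  0 < N -> c \in clauses p -> sat (truncated p N) e (clause_form p c).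
Proof.
move=> N0 cp; have [adm2 adm1] := admissible_clauses cp.
rewrite /clause_form; elim: (clause_bound c) e => [|m IH] e; last by move=> d; apply: IH.
have /(_ (fun v => val (e v))) cl := truncation_closed N0 cp.
have {cl} : (forall a, a \in c.1 -> sat (truncated p N) e (atom_form p a)) ->
    sat (truncated p N) e (atom_form p c.2).
  move=> H; apply/sat_atom => //; apply: cl => [i|a ac]; first exact: leq_ord.
  by apply/(sat_atom e (adm1 _ ac))/H.
rewrite /= /clause_matrix; elim: c.1 => [|a s IH] H; first exact: H.
move=> Ma; apply: IH => Ms; apply: H => a'; rewrite inE => /orP[/eqP->//|]; exact: Ms.
Qed.

(** Without function symbols a number is described by a formula about variable 0; under [Ex],
    variable 0 is the predecessor and variable 1 the number itself. *)
Fixpoint numeral n (p : recf n) (k : nat) : form (lang p) :=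
  if k is j.+1 then Ex (And (numeral p j) (atom_form p (IsSucc, [:: 0; 1])))
  else atom_form p (IsZero, [:: 0]).

(** The quantifiers bind [b], [l] and 1 in this order, whence the indices 2, 1 and 0. *)
Definition refutation (p : recf 2) (b l : nat) : form (lang p) :=
  All (Imp (numeral p b) (All (Imp (numeral p l) (All (Imp (numeral p 1)
    (Neg (atom_form p (Value p, [:: 0; 2; 1])))))))).

(** Existence of zero and of successors lets numbers be named; injectivity of the successor is not
    demanded, so finite models remain possible. *)
Definition clause_axioms (p : recf 2) : seq (form (lang p)) :=
  [:: Ex (atom_form p (IsZero, [:: 0])),
      All (Ex (atom_form p (IsSucc, [:: 1; 0])))
    & [seq clause_form p c | c <- clauses p]].

Definition refutable (p : recf 2) (b l : nat) : seq (form (lang p)) :=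
  refutation p b l :: clause_axioms p.

Lemma In_mapP (I : eqType) T (f : I -> T) s y :
  List.In y (map f s) <-> exists2 x, x \in s & y = f x.
Proof.
elim: s => [|x s IH] /=; first by split=> // -[].
split=> [[<-|/IH[z zs ->]]|[z + yE]]; first by exists x; rewrite ?mem_head.
  by exists z; rewrite // inE zs orbT.
by rewrite inE => /orP[/eqP zx|zs]; [left; rewrite yE zx | right; apply/IH; exists z].
Qed.

Lemma admissible_zero n (p : recf n) v : admissible p (IsZero, [:: v]).
Proof. by rewrite /admissible !inE eqxx. Qed.

Lemma admissible_succ n (p : recf n) v w : admissible p (IsSucc, [:: v; w]).
Proof. by rewrite /admissible !inE eqxx orbT. Qed.

Lemma admissible_value n (p : recf n) vs : size vs = n.+1 -> admissible p (Value p, vs).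
Proof. by move=> szvs; rewrite /admissible /well_formed !inE eqxx !orbT /= szvs eqxx. Qed.

Lemma bounded_numeral n (p : recf n) k m : bounded m.+1 (numeral p k).
Proof.
elim: k m => [|k IH] m.
  by apply: bounded_atom; [apply: admissible_zero | move=> v; rewrite inE => /eqP->].
do 3!(split=> //); split; first exact: IH.
split=> //; apply: bounded_atom; first exact: admissible_succ.
by move=> v; rewrite !inE => /orP[]/eqP->.
Qed.

Lemma refutable_theory (p : recf 2) b l : theory (fin_axioms (refutable p b l)).
Proof.
move=> phi [<-|[<-|[<-|/In_mapP[c cp ->]]]].
- do 4!(split; try exact: bounded_numeral) => //.
  apply: bounded_atom; first exact: admissible_value.
  by move=> v; rewrite !inE => /or3P[]/eqP->.
- split=> //; split=> //; apply: bounded_atom; first exact: admissible_zero.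
  by move=> v; rewrite inE => /eqP->.
- split=> //; split=> //; apply: bounded_atom; first exact: admissible_succ.
  by move=> v; rewrite !inE => /orP[]/eqP->.
- by apply: bounded_closure; rewrite addn0; apply: bounded_clause.
Qed.

Lemma index_zero n (p : recf n) : index IsZero (used_symbols p) = 0.
Proof. by rewrite /= eqxx. Qed.

Lemma index_succ n (p : recf n) : index IsSucc (used_symbols p) = 1.
Proof. by rewrite /= eqxx; case: eqP. Qed.

Lemma index_value n (p : recf n) : index (Value p) (used_symbols p) = 2.
Proof. by rewrite /= eqxx; do 2!case: eqP => //. Qed.

Lemma code_numeralE n (p : recf n) k : code_form (numeral p k) = code_numeral k.
Proof.
elim: k => [|k IH]; first by rewrite code_atom ?admissible_zero // index_zero.
by rewrite /numeral -/(numeral p k) code_Ex code_And IH code_atom ?admissible_succ // index_succ.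
Qed.

Lemma code_refutationE (p : recf 2) b l :
  code_form (refutation p b l) = code_refutation b l.
Proof.
rewrite /refutation !(code_numeralE, code_All, code_Imp, code_Neg).
by rewrite code_atom ?admissible_value // (index_value p).
Qed.

(** The diagonal instance. There is no circularity, as neither the signature nor [clause_axioms p]
    mentions the two numbers. *)
Definition self_refutable (p : recf 2) : seq (form (lang p)) :=
  refutable p (CodeSeq.code (rel_arities (lang p)))
              (CodeSeq.code [seq code_form phi | phi <- clause_axioms p]).

Lemma code_self_refutable (p : recf 2) :
  code_fin_axioms (self_refutable p) =
  code_refutable (CodeSeq.code (rel_arities (lang p)))
                 (CodeSeq.code [seq code_form phi | phi <- clause_axioms p]).
Proof.
by rewrite /code_fin_axioms /self_refutable /refutable map_cons code_refutationE !code_cons.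
Qed.

(** * Models and refutations of the theory *)

Lemma subst_Imp S s (phi psi : form S) :
  subst_form s (Imp phi psi) = Imp (subst_form s phi) (subst_form s psi).
Proof. by []. Qed.

Lemma subst_And S s (phi psi : form S) :
  subst_form s (And phi psi) = And (subst_form s phi) (subst_form s psi).
Proof. by []. Qed.

Lemma subst_Ex S s (phi : form S) : subst_form s (Ex phi) = Ex (subst_form (up s) phi).
Proof. by []. Qed.

(** The numerals are premises of [refutation], so in a model they are used in this direction; [minn]
    reflects the truncation. *)
Lemma sat_numeral n (p : recf n) N e k :
  sat (truncated p N) e (numeral p k) -> val (e 0) = minn k N.
Proof.
elim: k e => [|k IH] e.
  by move/(sat_atom e (admissible_zero p 0)) => /= ->; rewrite min0n.
move/sat_Ex => [d /sat_And[/IH /= dk]].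
by move/(sat_atom _ (admissible_succ p 0 1)) => /= ->; rewrite dk; lia.
Qed.

Lemma refutable_model (p : recf 2) b l N e phi :
  1 < N -> b < N -> l < N -> bounded_eval N p [:: b; l] 0 ->
  fin_axioms (refutable p b l) phi -> sat (truncated p N) e phi.
Proof.
move=> N1 bN lN p0 [<-|[<-|[<-|/In_mapP[c cp ->]]]].
- move=> x /sat_numeral xb y /sat_numeral yl w num1.
  have w1 := @sat_numeral _ p N (scons w (scons y (scons x e))) 1 num1.
  rewrite /= in xb yl w1.
  (* As p(b, l) evaluates to 0 within the bound, the atom would give 1 = 0. *)
  move/(sat_atom _ (@admissible_value _ p [:: 0; 2; 1] erefl)) => /= /(_ 0).
  rewrite xb yl w1 !(minn_idPl _) 1?ltnW // => /(_ p0) //.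
- apply/sat_Ex; exists ord0.
  by apply/(sat_atom _ (admissible_zero p 0)).
- move=> x; apply/sat_Ex; exists (inord (minn x.+1 N)).
  by apply/(sat_atom _ (admissible_succ p 1 0)); rewrite /= inordK // ltnS geq_minr.
- by apply: sat_clause => //; apply: ltnW.
Qed.

(* The variable N - i names the number i. *)
Definition named n (p : recf n) (A : form (lang p) -> Prop) N (phi : form (lang p)) : Prop :=
  [\/ A phi, phi = atom_form p (IsZero, [:: N]) |
      exists2 j, j < N & phi = atom_form p (IsSucc, [:: j.+1; j])].

Lemma shift_atom n (p : recf n) a :
  admissible p a -> shift (atom_form p a) = atom_form p (a.1, map S a.2).
Proof. by move=> adm; apply: subst_atom. Qed.

(** Names are discharged from the largest number down: it is variable 0, the witness of a successor
    axiom, and shifting raises the names of the smaller numbers. The name of zero goes last. *)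
Lemma named_bot n (p : recf n) (A : form (lang p) -> Prop) N :
  theory A -> A (Ex (atom_form p (IsZero, [:: 0]))) ->
  A (All (Ex (atom_form p (IsSucc, [:: 1; 0])))) ->
  proves (named A N) Bot -> proves A Bot.
Proof.
move=> thA A0 AS; elim: N => [|N IH] pf.
  apply: (exE_bot (Ax A0)); apply: weaken pf _ => phi [Aphi|->|[]//]; last by right.
  by left; exists phi; rewrite // /shift subst_sentence //; apply: thA.
apply: IH; apply: (@exE_bot _ _ (atom_form p (IsSucc, [:: 1; 0]))).
  (* [Var 0] names [N]; this instantiation leaves the indices 1 and 0 under [Ex] unchanged, whence
     [id]. *)
  have := AllE (Var 0) (Ax (Or31 _ _ AS) : proves (named A N) _).
  rewrite /inst subst_Ex (@subst_atom _ _ _ _ id) ?admissible_succ //.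
  by move=> v; rewrite !inE => /orP[]/eqP->.
apply: weaken pf _ => phi [Aphi|->|[[|j] jN ->]]; last 2 first.
- by right.
- left; exists (atom_form p (IsSucc, [:: j.+1; j])); last by rewrite shift_atom ?admissible_succ.
  by apply: Or33; exists j.
- left; exists phi; first exact: Or31.
  by rewrite /shift subst_sentence //; apply: thA.
- left; exists (atom_form p (IsZero, [:: N])); first exact: Or32.
  by rewrite shift_atom ?admissible_zero.
Qed.

(** The reading of atoms to which [closed_value] is applied: each number is replaced by the variable
    naming it. *)
Definition derivable n (p : recf n) A N (s : symbol) (xs : seq nat) : Prop :=
  proves (named A N) (atom_form p (s, [seq N - x | x <- xs])).

Lemma derivable_closed n (p : recf n) (A : form (lang p) -> Prop) N c :
  c \in clauses p -> A (clause_form p c) -> closed_under N (derivable A N) c.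
Proof.
move=> cp Ac s sN H; have [adm2 adm1] := admissible_clauses cp.
have := allE_closure (fun v => Var (N - s v)) (bounded_clause cp)
          (Ax (Or31 _ _ Ac) : proves (named A N) _).
have E a : admissible p a ->
    subst_form (fun v => Var (N - s v)) (atom_form p a) =
    atom_form p (a.1, [seq N - x | x <- map s a.2]).
  by move=> adm; rewrite (@subst_atom _ _ _ _ (fun v => N - s v)) // map_comp.
rewrite /clause_matrix /derivable.
elim: c.1 H adm1 => [|a cs IH] H adm1; first by rewrite (E c.2).
rewrite subst_Imp => pf; apply: IH => [a' a'c|a' a'c|].
- by apply: H; rewrite inE a'c orbT.
- by apply: adm1; rewrite inE a'c orbT.
apply: ImpE pf _; rewrite E; last by apply: adm1; rewrite mem_head.
by apply: H; rewrite mem_head.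
Qed.

Lemma derivable_numeral n (p : recf n) (A : form (lang p) -> Prop) N k s :
  k <= N -> s 0 = Var (N - k) -> proves (named A N) (subst_form s (numeral p k)).
Proof.
elim: k s => [|k IH] s kN s0.
  rewrite (@subst_atom _ _ _ _ (fun=> N)) ?admissible_zero //.
    by apply: Ax; apply: Or32.
  by move=> v; rewrite inE => /eqP->; rewrite s0 subn0.
rewrite -[numeral p k.+1]/(Ex (And (numeral p k) (atom_form p (IsSucc, [:: 0; 1])))).
(* The witness is the name of the predecessor [k]. *)
rewrite subst_Ex; apply: (@exI _ _ (Var (N - k))); rewrite /inst subst_form_comp subst_And.
apply: andI; first by apply: IH => //; apply: ltnW.
rewrite (@subst_atom _ _ _ _ (fun v => if v == 0 then N - k else N - k.+1)) ?admissible_succ //.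
  (* From [k < N], the successor of [N - k.+1] is [N - k]. *)
  apply: Ax; apply: Or33; exists (N - k.+1); first lia.
  by congr (atom_form p (_, [:: _; _])); rewrite /=; lia.
by move=> v; rewrite !inE => /orP[]/eqP-> //=; rewrite s0.
Qed.

Lemma allE_imp S (T : form S -> Prop) s t phi psi :
  proves T (subst_form s (All (Imp phi psi))) ->
  proves T (subst_form (scons t s) phi) -> proves T (subst_form (scons t s) psi).
Proof. by move=> /(allE_subst t); rewrite subst_Imp; apply: ImpE. Qed.

(** Once the numbers up to [N] are named, the clauses derive the atom for p(b, l) = 1, against
    [refutation]. *)
Lemma refutable_inconsistent (p : recf 2) b l N :
  0 < N -> b < N -> l < N -> bounded_eval N p [:: b; l] 1 ->
  proves (fin_axioms (refutable p b l)) Bot.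
Proof.
move=> N1 bN lN p1; set A := fin_axioms _.
have A0 : A (Ex (atom_form p (IsZero, [:: 0]))) by right; left.
have AS : A (All (Ex (atom_form p (IsSucc, [:: 1; 0])))) by right; right; left.
apply: (@named_bot _ p A N (@refutable_theory p b l) A0 AS).
have Ap : proves (named A N) (subst_form Var (refutation p b l)).
  rewrite subst_sentence; first by apply: Ax; apply: Or31; left.
  by apply: (@refutable_theory p b l); left.
have num k s : k <= N -> proves (named A N) (subst_form (scons (Var (N - k)) s) (numeral p k)).
  by move=> kN; apply: derivable_numeral.
have {}Ap := allE_imp Ap (num _ _ (ltnW bN)).
have {}Ap := allE_imp Ap (num _ _ (ltnW lN)).
have {}Ap := allE_imp Ap (num _ _ N1).
rewrite subst_Imp in Ap; apply: (ImpE Ap).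
(* The three instantiations have made variables 0, 1, 2 the names of 1, [l], [b]. *)
rewrite (@subst_atom _ _ _ _ (nth 0 [:: N - 1; N - l; N - b])) ?admissible_value //=.
  apply: (@closed_value N (derivable A N) _ p) p1 => //=.
  - by move=> c cp; apply: derivable_closed => //; do 3!right; apply/In_mapP; exists c.
  - by apply: Ax; apply: Or32; rewrite /= subn0.
  - move=> i iN; apply: Ax; apply: Or33; exists (N - i.+1); first lia.
    by congr (atom_form p (_, [:: _; _])); lia.
  - by rewrite (ltnW bN) (ltnW lN).
by move=> v; rewrite !inE => /or3P[]/eqP->.
Qed.

(** * The diagonal argument *)

Theorem theorem6p2 (S : signature) (U : form S -> Prop) :
  theory U -> consistent U -> effectively_friedman_reflexive U ->
  essentially_undecidable U.
Proof.
move=> _ _ [h rh hP] V _ VU Vcon [d rd dP].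
(* [p] finds the interpreter of the theory coded by [code_refutable b l] and asks [d] whether [V]
   proves it. *)
have [p pE] := computable_recursive rd (computable_recursive rh computable_code_refutable).
set b := CodeSeq.code (rel_arities (lang p)).
set l := CodeSeq.code [seq code_form phi | phi <- clause_axioms p].
have [C hC [sC intC]] := hP _ (self_refutable p) (@refutable_theory p b l).
have [N0 pN0] := eval_bounded (pE [tuple b; l]).
(* Large enough for the computation of [p] at [b] and [l], and for naming 1, [b] and [l]. *)
pose N := maxn N0 (maxn 2 (maxn b l).+1).
have [N1 bN lN] : [/\ 1 < N, b < N & l < N] by rewrite /N; split; lia.
(* Self-reference: at [b] and [l], [p] reports on the interpreter [C] of [self_refutable p]
   itself. *)
have pN : bounded_eval N p [:: b; l] (d (code_form C)).
  apply: bounded_eval_mono (leq_maxl _ _) _; move: pN0.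
  by rewrite -hC code_self_refutable.
have VC : proves V C <-> d (code_form C).
  split=> [VC|/dP[phi [_ /code_form_inj <-]] //]; by apply/dP; exists C.
(* [V] inherits from [U] its provable sentences only, so the derivation passes through the sentence
   [Imp phi psi]. *)
have Vimp phi psi : sentence phi -> sentence psi -> proves (extend U phi) psi ->
    proves V phi -> proves V psi.
  move=> sphi spsi pf; apply: ImpE; apply: VU; first by split.
  exact: ImpI.
case: (d _) pN VC => pN VC.
  have Vc : proves V C by apply/VC.
  (* [U + C] proves [C], hence interprets a theory that is inconsistent when p(b, l) = 1; [Bot]
     translates to [Bot]. *)
  have [tau tauP] : interprets (extend U C) (fin_axioms (self_refutable p)).
    by apply/intC => //; apply: Ax; right.
  apply: Vcon; apply: (Vimp C Bot) => //.
  apply: (tauP Bot) => //.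
  exact: (refutable_inconsistent (ltnW N1) bN lN pN).
have /VC // : proves V C.
(* The interpreter condition speaks of [U] extended by a sentence, here [Top]; the truncated model
   gives the interpretation when p(b, l) = 0. *)
apply: (Vimp Top C) => //; last exact: topI.
apply/intC => //; apply: (finite_model_interprets (M := truncated p N)) => e phi.
exact: (refutable_model e N1 bN lN pN).
Qed.
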